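(* Let $\mathcal{A}\subset\mathbb{Z}$ be a finite alphabet, let $G=(V,E)$ be a finite directed graph with edge labelling $\ell:E\to\mathcal{A}$, let $I\subseteq V$ be nonempty, and assume the matrix $M=\sum_{a\in\mathcal{A}}M_a$ is primitive. Let $\beta>1$ be a Pisot number, and let $\nu=(\phi^+)_*(\mu^+)$ and $\nu_I=(\phi_I^+)_*(\mu_I^+)$ be as described in the context. Then each of the measures $\nu_I$ and $\nu$ is pure: it is either absolutely continuous with respect to Lebesgue measure, or purely singular continuous, or purely atomic. The purely atomic case can only occur if the image $\phi^+(\mathcal{K}^+)$ is finite, and in that case the number of atoms is at most the number $\#V$ of vertices.
   Context: For $a\in\mathcal{A}$, $M_a$ is the $V\times V$ matrix with $(M_a)_{ij}=1$ if $(i,j)\in E$ and $\ell((i,j))=a$, and $0$ otherwise. By Perron–Frobenius, $M$ has a dominant eigenvalue $\lambda>0$ with positive left eigenvector $\mathbf v_L$ and positive right eigenvector $\mathbf v_R$, normalised by $\mathbf v_L^{\mathsf T}\mathbf v_R=1$. A path is a sequence of edges $e_1e_2\ldots$ with the terminal vertex of $e_j$ equal to the initial vertex of $e_{j+1}$. $\mathcal{K}^+\subseteq\mathcal{A}^{\mathbb{N}}$ is the set of sequences $(\ell(e_k))_{k\ge1}$ for infinite paths $e_1e_2\ldots$ in $G$, and $\mathcal{K}_I^+$ the subset obtained from infinite paths whose initial vertex lies in $I$. For a cylinder set $[\varepsilon_1,\ldots,\varepsilon_k]$ (sequences with $x_1=\varepsilon_1,\ldots,x_k=\varepsilon_k$),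 $\mu^+$ is the Borel probability measure on $\mathcal{K}^+$ with $\mu^+([\varepsilon_1,\ldots,\varepsilon_k])=\lambda^{-k}\mathbf v_L^{\mathsf T}M_{\varepsilon_1}\cdots M_{\varepsilon_k}\mathbf v_R$ (the shift-invariant measure of maximal entropy), and $\mu_I^+$ is the Borel probability measure on $\mathcal{K}_I^+$ with $\mu_I^+([\varepsilon_1,\ldots,\varepsilon_k])=\lambda^{-k}\mathbf v_I^{\mathsf T}M_{\varepsilon_1}\cdots M_{\varepsilon_k}\mathbf v_R/(\mathbf v_I^{\mathsf T}\mathbf v_R)$, where $\mathbf v_I$ is the indicator vector of $I$. A Pisot number is an algebraic integer $>1$ all of whose other Galois conjugates have modulus $<1$ (integers $\ge2$ included). The maps $\phi^+:\mathcal{K}^+\to\mathbb{R}$ and $\phi_I^+:\mathcal{K}_I^+\to\mathbb{R}$ are $(x_k)_{k\ge1}\mapsto\sum_{k\ge1}x_k\beta^{-k}$, and $f_*(\mu)$ denotes the push-forward measure. *)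

(* Defs.v *)
From HB Require Import structures.
From mathcomp Require Import all_boot all_order all_algebra.
From mathcomp Require Import all_classical all_reals all_analysis.
From mathcomp Require Import complex.
Set Implicit Arguments. Unset Strict Implicit. Unset Printing Implicit Defensive.
Import Order.TTheory GRing.Theory Num.Theory.
Import numFieldNormedType.Exports.
Local Open Scope classical_set_scope.
Local Open Scope ring_scope.

(* int is pointed (needed to form the generated sigma-algebra on Z^N) *)
HB.instance Definition _ := isPointed.Build int 0%R.

(* cylinder set [eps_1,...,eps_k] (indices shifted: x 0 = eps_1, ...) *)
Definition cyl (eps : seq int) : set (nat -> int) :=
  [set x | forall i, (i < size eps)%N -> x i = nth 0 eps i].

Definition cylinders : set (set (nat -> int)) := [set cyl eps | eps in setT].

Definition seqT := g_sigma_algebraType cylinders.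

Definition Mlab (R : pzRingType) n (E : rel 'I_n) (lab : 'I_n -> 'I_n -> int)
  (a : int) : 'M[R]_n :=
  \matrix_(i, j) ((E i j && (lab i j == a))%:R).

Definition Mtot (R : pzRingType) n (E : rel 'I_n) (lab : 'I_n -> 'I_n -> int)
  (A : seq int) : 'M[R]_n := \sum_(a <- A) Mlab R E lab a.

Definition Mword (R : pzRingType) n (E : rel 'I_n) (lab : 'I_n -> 'I_n -> int)
  (eps : seq int) : 'M[R]_n :=
  foldr (fun a P => Mlab R E lab a *m P) 1%:M eps.

Definition primitive_mx (R : numDomainType) n (M : 'M[R]_n) : Prop :=
  (forall i j, 0 <= M i j) /\
  exists k : nat, forall i j, 0 < (foldr mulmx 1%:M (nseq k M)) i j.

Definition Kplus n (E : rel 'I_n) (lab : 'I_n -> 'I_n -> int) : set (nat -> int) :=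
  [set x | exists v : nat -> 'I_n,
      forall k, E (v k) (v k.+1) /\ x k = lab (v k) (v k.+1)].

Definition KplusI n (E : rel 'I_n) (lab : 'I_n -> 'I_n -> int) (I : {set 'I_n}) :
  set (nat -> int) :=
  [set x | exists v : nat -> 'I_n, v 0%N \in I /\
      forall k, E (v k) (v k.+1) /\ x k = lab (v k) (v k.+1)].

(* beta > 1 is an algebraic integer (root of a monic irreducible integer
   polynomial = its minimal polynomial) whose other Galois conjugates
   (the other complex roots of that polynomial) have modulus < 1. *)
Definition pisot (R : rcfType) (beta : R) : Prop :=
  1 < beta /\
  exists p : {poly int},
    [/\ p \is monic,
        irreducible_poly (map_poly (fun z : int => z%:~R : rat) p),
        root (map_poly (fun z : int => z%:~R : R) p) beta &
        forall z : R[i], root (map_poly (fun z : int => z%:~R : R[i]) p) z ->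
          z != (beta%:C)%C -> `|z| < 1].

Definition phi (R : realType) (beta : R) (x : nat -> int) : R :=
  limn (series (fun k : nat => (x k)%:~R * beta ^- k.+1)).

Definition pushphi (R : realType) (beta : R) (mu : set seqT -> \bar R) :
  set R -> \bar R := fun B => mu (phi beta @^-1` B).

Definition abs_cont (R : realType) (nu : set R -> \bar R) : Prop :=
  forall B : set (measurableTypeR R), measurable B ->
    lebesgue_measure B = 0%E -> nu B = 0%E.

Definition sing_cont (R : realType) (nu : set R -> \bar R) : Prop :=
  (forall x : R, nu [set x] = 0%E) /\
  exists N : set (measurableTypeR R),
    [/\ measurable N, lebesgue_measure N = 0%E & nu (~` N) = 0%E].

Definition pure_atomic (R : realType) (nu : set R -> \bar R) : Prop :=
  exists S : set R, countable S /\ nu (~` S) = 0%E.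

Definition pure_measure (R : realType) (nu : set R -> \bar R) : Prop :=
  [\/ abs_cont nu, sing_cont nu | pure_atomic nu].

Definition atoms_at_most (R : realType) (nu : set R -> \bar R) (m : nat) : Prop :=
  exists s : seq R, (size s <= m)%N /\ forall x, (0 < nu [set x])%E -> x \in s.

(* Main.v *)
(* Let [p i j = E i j * vR j / (lam * vR i)] be the Parry transition
   probabilities and [nu i] the law of the labels read along the corresponding
   Markov chain started at the vertex [i]; both [mu] and [muI] are mixtures of
   the [nu i]. Reading the first edge gives
   [phi (a :: y) = (a + phi y) / beta], so that the images of the [nu i] form a
   self-similar family.
   Atoms: by the maximum principle the largest mass of an atom is the same at
   every vertex, and [x |-> beta x - lab i j] sends a largest atom at [i] to one
   at [j]. Largest atoms stay in a bounded set while the maps expand, so a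
   largest atom at [i] is the value of [phi] on every path starting at [i].
   Hence either there is no atom at all, or [phi] is constant on the paths
   issued from a given vertex.
   Without atoms: if a Lebesgue-null set is charged, enlarge it to a null set
   stable under all maps [y |-> (a + y) / beta] and their inverses. Its
   preimage under [phi] is shift-invariant, so a 0-1 law gives it full mass. *)
Require Import Defs.
From HB Require Import structures.
From mathcomp Require Import all_boot all_order all_algebra.
From mathcomp Require Import all_classical all_reals all_analysis.
From mathcomp Require Import complex measurable_realfun.
From mathcomp Require Import ring.
Import Order.TTheory GRing.Theory Num.Theory.
Import numFieldNormedType.Exports.
Local Open Scope classical_set_scope.
Local Open Scope ring_scope.

Set Implicit Arguments. Unset Strict Implicit.

(** * Measurability of [phi] on the sequence space *)

Lemma measurable_cvgn d (T : measurableType d) (R : realType) (h : nat -> T -> R) :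
  (forall m, measurable_fun setT (h m)) -> measurable [set x | cvgn (h ^~ x)].
Proof.
move=> mh.
(* By completeness, convergence is the Cauchy criterion; tolerances [m.+1%:R^-1] make every
   quantifier countable. *)
have -> : [set x | cvgn (h ^~ x)] = \bigcap_m \bigcup_N \bigcap_(k in [set k | (N <= k)%N])
    [set x | (`|h N x - h k x| < m.+1%:R^-1)].
  apply/seteqP; split => x /=.
    move=> /cvg_cauchy/cauchy_ballP cx m _.
    have m0 : (0 : R) < m.+1%:R^-1 by rewrite invr_gt0 ltr0n.
    have [[U V]/= [[N1 _ N1U] [N2 _ N2V]] UV] := cx _ m0.
    exists (maxn N1 N2) => // k /= Nk.
    have := UV (h (maxn N1 N2) x, h k x); apply; split => /=.
      by apply: N1U => /=; rewrite leq_maxl.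
    by apply: N2V => /=; rewrite (leq_trans _ Nk)// leq_maxr.
  move=> H; apply: cauchy_cvg; apply: cauchy_exP => e e0.
  have [m me] : exists m, m.+1%:R^-1 < e.
    have := @near_infty_natSinv_lt R (PosNum e0).
    by move=> [m _ /(_ m (leqnn m))]; exists m.
  have [N _ Nk] := H m I.
  exists (h N x); exists N => // k /= /(Nk k) /=.
  by rewrite /ball/= => /lt_trans; apply.
apply: bigcapT_measurable => m; apply: bigcupT_measurable => N.
apply: bigcap_measurable; first by exists N => /=.
move=> k _.
have : measurable_fun setT (fun x => `|h N x - h k x|).
  by apply: measurableT_comp => //; exact: measurable_funB.
move=> /(_ measurableT `]-oo, m.+1%:R^-1[%classic (measurable_itv _)).
by rewrite setTI; congr measurable; apply/seteqP; split => y /=; rewrite in_itv.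
Qed.

(* Divergent sequences form a measurable set, on which [limn] is the constant
   junk value [point]. *)
Lemma measurable_fun_limn d (T : measurableType d) (R : realType) (h : nat -> T -> R) :
  (forall m, measurable_fun setT (h m)) ->
  measurable_fun setT (fun x => limn (h ^~ x) : R).
Proof.
move=> mh; pose C := [set x | cvgn (h ^~ x)].
have mC : measurable C by exact: measurable_cvgn.
rewrite -(setUv C); apply/measurable_funU => //; first exact: measurableC.
split.
  apply: (@measurable_fun_cvg _ _ _ _ h) => // m.
  exact: (@measurable_funS _ _ _ _ setT).
apply: (@eq_measurable_fun _ _ _ _ _ (cst point)) => //.
by move=> x; rewrite inE => /= nC; rewrite dvgP.
Qed.

Lemma measurable_cyl (eps : seq int) : measurable (cyl eps : set seqT).
Proof. by apply: sub_sigma_algebra; exists eps. Qed.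

Lemma measurable_coord (k : nat) (P : set int) : measurable ([set x | P (x k)] : set seqT).
Proof.
(* There are countably many words, so a condition on coordinate [k] is a countable union of
   cylinders over words of length [k.+1]. *)
pose C (e : seq int) : set seqT :=
  if (size e == k.+1) && `[< P (nth 0 e k) >] then cyl e else set0.
suff -> : [set x : seqT | P (x k)] = \bigcup_(e in setT) C e.
  apply: countable_bigcupT_measurable; first exact: countableP.
  by move=> e; rewrite /C; case: ifP => // _; exact: measurable_cyl.
apply/seteqP; split => x /=.
  move=> Px; exists (mkseq x k.+1) => //.
  rewrite /C size_mkseq eqxx nth_mkseq//; case: asboolP => //= _ i.
  by rewrite size_mkseq => ik; rewrite nth_mkseq.
move=> [e _]; rewrite /C; case: ifP => // /andP[/eqP se /asboolP Pe] xe.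
by rewrite /= xe// se.
Qed.

Lemma measurable_phi (R : realType) (beta : R) :
  measurable_fun setT (phi beta : seqT -> R).
Proof.
apply: measurable_fun_limn => m; rewrite /series/=.
apply: (@measurable_sum _ _ _ _ _ _ _) => k.
apply: (@measurable_funM _ _ _ _ (fun x : seqT => (x k)%:~R) (cst (beta ^- k.+1))) => //.
by move=> _ Y mY; rewrite setTI; exact: (measurable_coord k [set z | Y z%:~R]).
Qed.

(** * Prefixing a letter, and the functional equation of [phi] *)

Definition scons (a : int) (y : nat -> int) : nat -> int :=
  fun k => if k is k'.+1 then y k' else a.

Section phi_theory.
Variables (R : realType) (beta : R).
Hypothesis beta1 : 1 < beta.

Let beta_gt0 : 0 < beta. Proof. exact: lt_trans ltr01 beta1. Qed.

Let term (x : nat -> int) (k : nat) : R := (x k)%:~R * beta ^- k.+1.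

Lemma expV_cvg0 : (beta^-1 ^+ n) @[n --> \oo] --> (0 : R).
Proof.
by apply: cvg_expr; rewrite gtr0_norm ?invr_gt0// invf_lt1.
Qed.

(** Unrolling the recursion, the [n]-th partial sum is [t 0 - beta^-n * t n], and boundedness of [t]
    kills the remainder: only the true value of [phi] has a bounded orbit under the expanding
    maps. *)
Lemma phi_orbit (x : nat -> int) (t : nat -> R) (K : R) :
  (forall k, t k.+1 = beta * t k - (x k)%:~R) -> (forall k, `|t k| <= K) ->
  phi beta x = t 0%N.
Proof.
move=> tS tK; apply/cvg_lim => //.
have E : series (term x) = fun n => t 0%N - beta^-1 ^+ n * t n.
  apply/funext => n; elim: n => [|n IH].
    by rewrite /series/= big_geq// expr0 mul1r subrr.
  rewrite /series/= big_nat_recr//= -[X in X + _]/(series (term x) n) IH /term tS.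
  rewrite -exprVn exprS; field; exact: lt0r_neq0.
rewrite -/(term x) E -[X in _ --> X]subr0.
apply: cvgB; first exact: cvg_cst.
apply/norm_cvg0P.
apply: (@squeeze_cvgr _ _ _ _ (cst 0) (fun n => beta^-1 ^+ n * K)).
- near=> n; rewrite normr_ge0 normrM ger0_norm; last by rewrite exprn_ge0// invr_ge0 ltW.
  by rewrite ler_wpM2l// exprn_ge0// invr_ge0 ltW.
- exact: cvg_cst.
- by rewrite -[X in _ --> X](mul0r K); apply: cvgMr_tmp; exact: expV_cvg0.
Unshelve. all: end_near. Qed.

Variables (y : nat -> int) (L : R).
Hypothesis yL : forall k, `|(y k)%:~R| <= L :> R.

Lemma normed_series_term_cvg :
  cvgn [normed series (term y)] /\ limn [normed series (term y)] <= L / (beta - 1).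
Proof.
have cG := @cvg_geometric_series R (L * beta^-1) (beta^-1) _.
have {}cG : series (geometric (L * beta^-1) beta^-1) @ \oo --> L / (beta - 1).
  have -> : L / (beta - 1) = L / beta / (1 - beta^-1).
    by field; rewrite lt0r_neq0// subr_eq0 gt_eqF.
  by apply: cvg_geometric_series; rewrite gtr0_norm ?invr_gt0// invf_lt1.
have b0 : 0 <= beta^-1 by rewrite invr_ge0 ltW.
have le k : `|term y k| <= geometric (L * beta^-1) beta^-1 k.
  rewrite /term normrM -exprVn (ger0_norm (exprn_ge0 _ b0)).
  rewrite /geometric/= exprS mulrA ler_wpM2r ?exprn_ge0//.
  by rewrite ler_wpM2r.
have cN : cvgn [normed series (term y)].
  apply: (@series_le_cvg _ _ (geometric (L * beta^-1) beta^-1)) => //.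
  - by move=> k; exact: normr_ge0.
  - by move=> k; rewrite (le_trans _ (le k)).
  - by apply/cvg_ex; eexists; exact: cG.
split => //; rewrite -(cvg_lim _ cG)//.
apply: ler_lim => //; first by apply/cvg_ex; eexists; exact: cG.
by near=> n; rewrite /series/= ler_sum.
Unshelve. all: end_near. Qed.

Lemma phi_norm_le : `|phi beta y| <= L / (beta - 1).
Proof.
have [cN leN] := normed_series_term_cvg.
by rewrite (le_trans _ leN)//; exact: (lim_series_norm cN).
Qed.

(** The digit bound makes [phi beta y] a genuine limit instead of the default value of [limn]; the
    first term of the series for [scons a y] is then split off. *)
Lemma phi_scons (a : int) : phi beta (scons a y) = (a%:~R + phi beta y) / beta.
Proof.
have cy : series (term y) @ \oo --> phi beta y.
  exact: (normed_cvg (proj1 normed_series_term_cvg)).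
apply/cvg_lim => //; rewrite -(cvg_shiftn 1) /=.
rewrite (_ : (fun n => _) = fun n => (a%:~R + series (term y) n) / beta).
  by apply: cvgMr_tmp; apply: cvgD => //; exact: cvg_cst.
apply/funext => n; rewrite addn1 /series/= big_nat_recl//= mulrDl expr1; congr (_ + _).
by rewrite big_distrl/=; apply: eq_bigr => i _; rewrite /term -mulrA -invfM -exprSr.
Qed.

End phi_theory.

(** * Lebesgue measure under affine maps *)

Lemma measurable_affine (R : realType) (b c : R) :
  measurable_fun setT ((fun y => b * y + c) : measurableTypeR R -> measurableTypeR R).
Proof.
apply: measurable_funD; last exact: measurable_cst.
by apply: measurable_funM; [exact: measurable_cst|exact: measurable_id].
Qed.

(** The pushforward under the affine map, scaled by [b], gives every interval []u, v]] its length,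
    so it is Lebesgue measure by uniqueness. *)
Lemma lebesgue_measure_affine (R : realType) (b c : R) (S : set (measurableTypeR R)) :
  0 < b -> measurable S ->
  lebesgue_measure ((fun y => b * y + c) @^-1` S : set (measurableTypeR R))
    = (b^-1%:E * lebesgue_measure S)%E.
Proof.
move=> b0 mS; pose f : measurableTypeR R -> measurableTypeR R := fun y => b * y + c.
have mf : measurable_fun setT f := measurable_affine b c.
have b0' : 0 <= b by exact: ltW.
have E : lebesgue_measure S = (b%:E * lebesgue_measure (f @^-1` S))%E.
  pose m : {measure set (measurableTypeR R) -> \bar R} :=
    mscale (NngNum b0')
      (measure_function_pushforward__canonical__measure_function_Measure lebesgue_measure mf).
  apply: (@lebesgue_measure_unique R m) => //= _ [[u v]] _ <-.
  rewrite /m /mscale/= /pushforward.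
  have -> : f @^-1` `]u, v]%classic = `](u - c) / b, (v - c) / b]%classic.
    apply/seteqP; split=> y; rewrite /f/= !in_itv/= ltr_pdivrMr// ler_pdivlMr//;
      by rewrite ltrBlDr lerBrDr [y * b]mulrC.
  rewrite !lebesgue_measure_itv/= !lte_fin ltr_pM2r ?invr_gt0// ltrD2r.
  case: ifP => _; last by rewrite mule0.
  rewrite -!EFinB -EFinM; congr _%:E; field; exact: lt0r_neq0.
by rewrite E muleA -EFinM mulVf ?lt0r_neq0// mul1e.
Qed.

(** * Markov laws of label sequences, coded on the unit interval *)

Lemma measurable_seqTP d (T : measurableType d) (f : T -> seqT) :
  (forall e, measurable (f @^-1` cyl e)) -> measurable_fun setT f.
Proof.
move=> H; refine (@measurability _ _ T seqT setT f cylinders _ _) => //.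
by move=> _ [_ [e _ <-] <-]; rewrite setTI.
Qed.

Lemma measurable_scons a : measurable_fun setT (scons a : seqT -> seqT).
Proof.
apply: measurable_seqTP => -[|b e].
  by rewrite (_ : _ @^-1` _ = setT)//; apply/seteqP; split.
rewrite (_ : _ @^-1` _ = if a == b then cyl e else set0).
  by case: ifP => // _; exact: measurable_cyl.
apply/seteqP; split=> x /=.
  by move=> H; have /= -> := H 0%N isT; rewrite eqxx => k ke; exact: (H k.+1).
by case: eqP => // -> H [|k] //= ke; exact: H.
Qed.

(** Positivity of [p] stands for the edge relation, so that the chain can be studied without the
    graph. *)
Definition path_word (R : realType) (n : nat) (p : 'I_n -> 'I_n -> R)
    (lab : 'I_n -> 'I_n -> int) (i : 'I_n) (x : nat -> int) :=
  exists v : nat -> 'I_n, [/\ v 0%N = i, forall k, 0 < p (v k) (v k.+1) &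
     x = fun k => lab (v k) (v k.+1)].

(* The laws are realised on Lebesgue [0, 1[: cut it into intervals of lengths
   [p i j], move to the [j] whose interval contains [u], and rescale that
   interval back to [0, 1[. *)
Section coding.
Variables (R : realType) (n : nat) (p : 'I_n -> 'I_n -> R).
Variable lab : 'I_n -> 'I_n -> int.
Hypothesis p_ge0 : forall i j, 0 <= p i j.
Hypothesis p_sum1 : forall i, \sum_j p i j = 1.

Let cum i m := \sum_(k < n | (k < m)%N) p i k.
Let cell i (j : 'I_n) : set (measurableTypeR R) := `[cum i j, cum i j.+1[%classic.

Let cumS i (j : 'I_n) : cum i j.+1 = cum i j + p i j.
Proof.
rewrite /cum (bigD1 j)//= addrC; congr (_ + _); apply: eq_bigl => k.
by rewrite ltnS ltn_neqAle andbC.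
Qed.

Let le_cum i m m' : (m <= m')%N -> cum i m <= cum i m'.
Proof.
move=> mm'; rewrite /cum big_mkcond [leRHS]big_mkcond ler_sum// => k _.
by case: ifP => [km|_]; [rewrite (leq_trans km mm')|case: ifP].
Qed.

Let cell_inj i j j' u : cell i j u -> cell i j' u -> j = j'.
Proof.
rewrite /cell/= !in_itv/= => /andP[a b] /andP[c d]; apply: val_inj; apply/eqP.
rewrite eqn_leq; apply/andP; split; rewrite leqNgt; apply/negP => /(le_cum i) h.
  by have := lt_le_trans d (le_trans h a); rewrite ltxx.
by have := lt_le_trans b (le_trans h c); rewrite ltxx.
Qed.

Let cell_ex i (u : R) : 0 <= u < 1 -> exists j, cell i j u.
Proof.
move=> /andP[u0 u1].
have n0 : (0 < n)%N by apply: leq_trans (ltn_ord i).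
have un : u < cum i n.-1.+1.
  suff -> : cum i n.-1.+1 = 1 by [].
  by rewrite -(p_sum1 i) prednK//; apply: eq_bigl => k; rewrite ltn_ord.
case: (ex_minnP (ex_intro (fun m => u < cum i m.+1) _ un)) => m um mmin.
have mn : (m < n)%N.
  rewrite ltnNge; apply/negP => nm.
  by have := mmin _ un; rewrite leqNgt (leq_trans _ nm)// ltn_predL.
exists (Ordinal mn); rewrite /cell/= in_itv/= um andbT.
case: m um mmin mn => [|m] um mmin mn.
  by rewrite /cum big_pred0.
by rewrite leNgt; apply/negP => /mmin; rewrite ltnn.
Qed.

Let cell_sub i j u : cell i j u -> 0 <= u < 1.
Proof.
rewrite /cell/= in_itv/= => /andP[a b]; apply/andP; split.
  by apply: le_trans a; apply: sumr_ge0.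
apply: (lt_le_trans b); rewrite -(p_sum1 i) [leRHS](bigID (fun k : 'I_n => (k < j.+1)%N))/=.
by rewrite lerDl sumr_ge0.
Qed.

Let cell_p i j u : cell i j u -> 0 < p i j.
Proof.
rewrite /cell/= in_itv/= cumS => /andP[a b].
by rewrite -(ltrD2l (cum i j)) addr0 (le_lt_trans a).
Qed.

(** The cells of [i] cover exactly [0, 1[; at any other [u] the default [i] is returned, which
    accounts for the complement appearing in [measurable_next]. *)
Let next i (u : R) := odflt i [pick j | `[< cell i j u >]].

Let next_cell i j u : cell i j u -> next i u = j.
Proof.
move=> cu; rewrite /next; case: pickP => [k /asboolP ck|/(_ j)/=]; first exact: cell_inj ck cu.
by case: asboolP.
Qed.

Let rescale i (j : 'I_n) (u : R) : R := (u - cum i j) / p i j.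
Let step (s : 'I_n * R) := (next s.1 s.2, rescale s.1 (next s.1 s.2) s.2).
Let walk i (u : R) k := (iter k step (i, u)).1.
Let word i (u : R) : seqT := fun k => lab (walk i u k) (walk i u k.+1).

Let rescale_cell i j u : 0 < p i j -> 0 <= rescale i j u < 1 <-> cell i j u.
Proof.
move=> p0; rewrite /cell /rescale/= in_itv/= cumS ler_pdivlMr// mul0r subr_ge0.
by rewrite ltr_pdivrMr// mul1r ltrBlDl.
Qed.

Let walk_path i (u : R) : 0 <= u < 1 -> forall k, 0 < p (walk i u k) (walk i u k.+1).
Proof.
move=> u01 k.
have H : 0 <= (iter k step (i, u)).2 < 1.
  elim: k => //= k; set s := iter k step _ => /(cell_ex s.1)[j cj].
  by rewrite (next_cell cj) (rescale_cell _ (cell_p cj)).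
rewrite /walk/=; have [j cj] := cell_ex (iter k step (i, u)).1 H.
by rewrite (next_cell cj) (cell_p cj).
Qed.

Let wordE i u j : next i u = j -> word i u = scons (lab i j) (word j (rescale i j u)).
Proof.
move=> nj; apply/funext => -[|k]; rewrite /word /walk; first by rewrite /= nj.
by rewrite /scons (iterSr k step (i, u)) (iterSr k.+1 step (i, u)) {2 4}/step/= nj.
Qed.

Let measurable_rescale i j :
  measurable_fun setT (rescale i j : measurableTypeR R -> measurableTypeR R).
Proof.
rewrite (_ : rescale i j = fun u => (p i j)^-1 * u + (- (cum i j / p i j))).
  exact: (measurable_affine (p i j)^-1 (- (cum i j / p i j))).
by apply/funext => u; rewrite /rescale mulrBl mulrC.
Qed.

Let measurable_cell i j : measurable (cell i j).
Proof. exact: measurable_itv. Qed.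

Let measurable_next i j : measurable ([set u | next i u = j] : set (measurableTypeR R)).
Proof.
rewrite (_ : [set u | _] =
    cell i j `|` (if i == j then ~` (\bigcup_(k in [set: 'I_n]) cell i k) else set0)).
  apply: measurableU => //; case: ifP => // _; apply: measurableC.
  by apply: fin_bigcup_measurable => // k _; exact: measurable_cell.
apply/seteqP; split => u /=.
  rewrite /next; case: pickP => [k /asboolP ck /= <-|ck /= <-]; [by left|right].
  by rewrite eqxx => -[k _]/=; move: (ck k); case: asboolP.
case=> [/next_cell//|]; case: eqP => // <- nck.
rewrite /next; case: pickP => // k /asboolP ck.
by exfalso; apply: nck; exists k.
Qed.

Let measurable_word i : measurable_fun setT (word i : measurableTypeR R -> seqT).
Proof.
apply: measurable_seqTP => e; elim: e i => [|a e IH] i.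
  by rewrite (_ : _ @^-1` _ = setT)//; apply/seteqP; split.
(* The next vertex [j] determines the first letter, and the remaining letters are the word of [j] at
   the rescaled point, to which the induction applies. *)
rewrite (_ : _ @^-1` _ = \bigcup_(j in [set j | lab i j = a])
   ([set u | next i u = j] `&` rescale i j @^-1` (word j @^-1` cyl e))).
  apply: fin_bigcup_measurable => // j _; apply: measurableI => //.
  by rewrite -[X in measurable X]setTI; apply: measurable_rescale.
apply/seteqP; split => u /=.
  move=> H; exists (next i u); rewrite ?(wordE (erefl (next i u))) /=.
    by have /= := H 0%N isT; rewrite (wordE (erefl (next i u))).
  split=> // k ke; have := H k.+1 ke.
  by rewrite (wordE (erefl (next i u))).
by move=> [j /= la [nj H]] [|k] ke; rewrite (wordE nj)//=; exact: H.
Qed.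

Let unit_itv : set (measurableTypeR R) := `[0, 1[%classic.
Let munit : measurable unit_itv. Proof. exact: measurable_itv. Qed.

Definition coded_law i (S : set seqT) :=
  pushforward (mrestr lebesgue_measure munit) (word i) S.

HB.instance Definition _ i := Measure.copy (coded_law i)
  (measure_function_pushforward__canonical__measure_function_Measure
    (mrestr lebesgue_measure munit) (measurable_word i)).

Lemma coded_lawT i : coded_law i setT = 1%E.
Proof.
rewrite /coded_law /pushforward /mrestr preimage_setT setTI.
by rewrite lebesgue_measure_itv/= lte_fin ltr01 oppr0 adde0.
Qed.

HB.instance Definition _ i := Measure_isProbability.Build _ _ _ (coded_law i) (coded_lawT i).

Lemma coded_law_path i (S : set seqT) :
  (forall v : nat -> 'I_n, v 0%N = i -> (forall k, 0 < p (v k) (v k.+1)) ->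
     S (fun k => lab (v k) (v k.+1))) ->
  coded_law i S = 1%E.
Proof.
move=> H; rewrite -(coded_lawT i) /coded_law /pushforward /mrestr; congr lebesgue_measure.
apply/seteqP; split=> u /= [_ u01]; split=> //=.
by apply: (H (walk i u)) => //; apply: walk_path; move: u01; rewrite /unit_itv/= in_itv.
Qed.

(** Markov property: on the cell of [j] the word is the label of the edge followed by the word of
    [j] at the rescaled point, and rescaling divides lengths in that cell by [p i j]. Cells with
    [p i j = 0] are empty. *)
Lemma coded_law_step i (S : set seqT) : measurable S ->
  coded_law i S = (\sum_j (p i j)%:E * coded_law j (scons (lab i j) @^-1` S))%E.
Proof.
move=> mS.
have mw k (S' : set seqT) : measurable S' -> measurable (word k @^-1` S').
  by move=> mS'; rewrite -[X in measurable X]setTI; apply: measurable_word.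
have mscons a : measurable (scons a @^-1` S : set seqT).
  by rewrite -[X in measurable X]setTI; apply: measurable_scons.
pose F j := cell i j `&` word i @^-1` S.
rewrite {1}/coded_law /pushforward /mrestr.
have -> : word i @^-1` S `&` unit_itv = \big[setU/set0]_(j < n) F j.
  rewrite -bigcup_seq; apply/seteqP; split=> u /=.
    rewrite /unit_itv/= in_itv/= => -[Su /(cell_ex i)[j cj]].
    by exists j => //=; rewrite mem_index_enum.
  move=> [j _ [cj Su]]; split=> //.
  by rewrite /unit_itv/= in_itv/=; exact: cell_sub cj.
rewrite measure_bigsetU_ord//=; last 2 first.
- by move=> j; apply: measurableI => //; exact: mw.
- by move=> j k _ _ [u [[cj _] [ck _]]]; exact: cell_inj cj ck.
apply: eq_bigr => j _; have := p_ge0 i j; rewrite le_eqVlt => /predU1P[p0|p0].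
  rewrite -p0 mul0e; rewrite (_ : F j = set0) ?measure0//.
  by apply/seteqP; split => u //= [/cell_p]; rewrite -p0 ltxx.
rewrite /coded_law /pushforward /mrestr.
set A := _ `&` _.
have -> : F j = (fun y => (p i j)^-1 * y + - (cum i j / p i j)) @^-1` A.
  have rE u : (p i j)^-1 * u + - (cum i j / p i j) = rescale i j u.
    by rewrite /rescale mulrBl mulrC.
  apply/seteqP; split => u /=.
    move=> [cj Su]; rewrite rE; split => /=.
      by rewrite -(wordE (next_cell cj)).
    by rewrite /unit_itv/= in_itv/=; apply/rescale_cell.
  rewrite rE /A/= /unit_itv/= in_itv/= => -[Su /(rescale_cell _ p0) cj].
  by split => //=; rewrite (wordE (next_cell cj)).
rewrite lebesgue_measure_affine ?invr_gt0 ?invrK//.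
by apply: measurableI => //; exact: mw.
Qed.

(** These two properties are all that the later arguments retain of the coding. *)
Lemma markov_laws_exist : exists nu : 'I_n -> probability seqT R,
  (forall i (S : set seqT), measurable S -> path_word p lab i `<=` S -> nu i S = 1%E) /\
  (forall i (S : set seqT), measurable S ->
     nu i S = (\sum_j (p i j)%:E * nu j (scons (lab i j) @^-1` S))%E).
Proof.
exists (fun i => [the probability seqT R of coded_law i]).
split=> i S mS; last exact: coded_law_step.
by move=> iS; apply: coded_law_path => v vi vp; apply: iS; exists v.
Qed.

End coding.

(** * Stable null sets, and uniqueness of measures on cylinders *)

Lemma null_orbit_closure (R : realType) (beta : R) (B : set (measurableTypeR R)) :
  0 < beta -> measurable B -> lebesgue_measure B = 0%E ->
  exists N : set (measurableTypeR R), [/\ measurable N, lebesgue_measure N = 0%E, B `<=` N &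
    forall (a : int) y, N ((a%:~R + y) / beta) <-> N y].
Proof.
move=> b0 mB B0; have bneq0 : beta != 0 by exact: lt0r_neq0.
pose null (C : set (measurableTypeR R)) := measurable C /\ lebesgue_measure C = 0%E.
pose T (a : int) (y : R) : R := beta^-1 * y + a%:~R / beta.
pose U (a : int) (y : R) : R := beta * y + - a%:~R.
have TE a y : T a y = (a%:~R + y) / beta by rewrite /T mulrDl addrC (mulrC y).
have UT a y : U a (T a y) = y by rewrite TE /U; field.
have null_affine b c C : 0 < b -> null C -> null ((fun y => b * y + c) @^-1` C).
  move=> bp [mC C0]; split; last by rewrite lebesgue_measure_affine// C0 mule0.
  by have := measurable_affine b c measurableT mC; rewrite setTI.
have null_bigcup (F : nat -> set (measurableTypeR R)) :
    (forall k, null (F k)) -> null (\bigcup_k F k).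
  move=> nF; have mF : measurable (\bigcup_k F k).
    by apply: bigcupT_measurable => k; case: (nF k).
  split=> //; apply/(negligibleP _ mF); apply: negligible_bigcup => k.
  by case: (nF k) => mk k0; apply/negligibleP.
have nullU C D : null C -> null D -> null (C `|` D).
  move=> [mC C0] [mD D0]; split; first exact: measurableU.
  by rewrite measureU0// D0.
(* [dec] enumerates all integers, possibly with repetitions; indices coding no integer give 0. *)
pose dec k : int := odflt 0 (unpickle k).
(* Preimages under [T] and under its inverse [U] are both added, so that the limit set is stable in
   both directions. Countably many affine preimages of null sets remain null at each stage. *)
pose enlarge (C : set (measurableTypeR R)) :=
  C `|` \bigcup_k (T (dec k) @^-1` C `|` U (dec k) @^-1` C).
pose it k := iter k enlarge B.
have null_it k : null (it k).
  elim: k => [//|k IH]; apply: (nullU) => //; apply: (null_bigcup) => l.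
  by apply: (nullU); apply: (null_affine); rewrite ?invr_gt0.
have decK a : dec (pickle a) = a by rewrite /dec pickleK.
have [mN N0] := null_bigcup _ null_it.
exists (\bigcup_k it k); split => //; first by move=> y By; exists 0%N.
move=> a y; rewrite -TE; split=> -[k _ ky]; exists k.+1 => //; right; exists (pickle a) => //=.
  by left; rewrite decK.
by right; rewrite decK UT.
Qed.

Lemma scons_preimage_cyl l a e :
  scons l @^-1` cyl (a :: e) = if l == a then cyl e else set0.
Proof.
apply/seteqP; split=> x /=.
  by move=> H; have /= -> := H 0%N isT; rewrite eqxx => k ke; exact: (H k.+1).
by case: eqP => // -> H [|k] //= ke; exact: H.
Qed.

Lemma cyl_nil : cyl [::] = setT.
Proof. by apply/seteqP; split. Qed.

Lemma cyl_measure_unique (R : realType) (m1 m2 : {measure set seqT -> \bar R}) :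
  (forall e, m1 (cyl e) = m2 (cyl e)) -> (m1 setT < +oo)%E ->
  forall S, measurable S -> m1 S = m2 S.
Proof.
move=> m12 m1T S mS.
(* Two cylinders are nested or disjoint, so adjoining the empty set gives a generating family closed
   under intersection. *)
pose G := cylinders `|` [set set0].
apply: (@measure_unique _ R seqT G (fun=> setT)) => //.
- apply/seteqP; split.
    apply: smallest_sub; first exact: smallest_sigma_algebra.
    by move=> A GA; apply: sub_sigma_algebra; left.
  apply: smallest_sub; first exact: sigma_algebra_measurable.
  by move=> A [[e _ <-]|->]; [exact: measurable_cyl|exact: measurable0].
- move=> A B [[e _ <-]|->]; last by move=> _; rewrite set0I; right.
  move=> [[f _ <-]|->]; last by rewrite setI0; right.
  have [[x [xe xf]]|H] := pselect (exists x, cyl e x /\ cyl f x); last first.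
    by right; apply/seteqP; split => // x [xe xf]; apply: H; exists x.
  left; wlog fe : e f xe xf / (size f <= size e)%N.
    move=> wl; have [/wl|/ltnW/wl] := leqP (size f) (size e); first exact.
    by rewrite setIC; exact.
  exists e => //; apply/seteqP; split=> y /=; last by case.
  move=> ye; split => // k kf; have ke := leq_trans kf fe.
  by rewrite ye// -xe// xf.
- by move=> k; left; exists [::] => //; rewrite cyl_nil.
- by rewrite bigcup_const//; exists 0%N.
- by move=> A [[e _ <-]|->]; rewrite ?measure0.
Qed.

(** * Irreducible stochastic matrices and the 0-1 law *)

Section stochastic.
Variables (R : realType) (n : nat) (p : 'I_n -> 'I_n -> R).
Hypothesis p_ge0 : forall i j, 0 <= p i j.
Hypothesis p_sum1 : forall i, \sum_j p i j = 1.

(** Maximum principle: the nonnegative defects [m - g j] have weighted sum 0, so each one of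
    positive weight vanishes. *)
Lemma average_max (m : R) (g : 'I_n -> R) i : (forall j, g j <= m) ->
  \sum_j p i j * g j = m -> forall j, 0 < p i j -> g j = m.
Proof.
move=> gm gE j pj.
have : \sum_j p i j * (m - g j) = 0.
  under eq_bigr do rewrite mulrBr.
  by rewrite sumrB gE -big_distrl/= p_sum1 mul1r subrr.
move=> /eqP; rewrite psumr_eq0; last by move=> k _; rewrite mulr_ge0// subr_ge0.
move=> /allP/(_ j); rewrite mem_index_enum => /(_ isT).
by rewrite mulf_eq0 gt_eqF//= subr_eq0 => /eqP.
Qed.

Hypothesis p_irr : forall i j, connect (fun i j => 0 < p i j) i j.

Lemma irreducible_closed (P : 'I_n -> Prop) :
  (forall i j, P i -> 0 < p i j -> P j) -> forall i, P i -> forall j, P j.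
Proof.
move=> Pcl i Pi j; have /connectP[s + ->] := p_irr i j.
elim: s i Pi => //= k s IH i Pi /andP[pik ps].
by apply: IH ps; exact: Pcl pik.
Qed.

(** By the maximum principle the set where [f] attains its maximum is closed under positive
    transitions, hence is everything by irreducibility. *)
Lemma harmonic_const (f : 'I_n -> R) :
  (forall i, f i = \sum_j p i j * f j) -> forall i j, f i = f j.
Proof.
move=> fE i j.
have [k _ kmax] := @arg_maxP _ _ _ i xpredT f isT.
have fk : forall l, f l = f k.
  apply: (@irreducible_closed (fun l => f l = f k) _ k) => // a b fa pab.
  by apply: (@average_max _ _ a) => //; [move=> c; exact: kmax|rewrite -fE].
by rewrite !fk.
Qed.

Variable lab : 'I_n -> 'I_n -> int.
Variable nu : 'I_n -> probability seqT R.

Local Notation path_word := (path_word p lab).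

Hypothesis nu_path : forall i (S : set seqT),
  measurable S -> path_word i `<=` S -> nu i S = 1%E.
Hypothesis nu_step : forall i (S : set seqT), measurable S ->
  nu i S = (\sum_j (p i j)%:E * nu j (scons (lab i j) @^-1` S))%E.

(** The measurable set [T] where [S] and [S'] agree contains all path words from [i], hence has full
    mass. This lets identities for [phi] that rely on bounded digits be used under [nu i]. *)
Lemma nu_ae_eq i (S S' : set seqT) : measurable S -> measurable S' ->
  (forall x, path_word i x -> S x <-> S' x) -> nu i S = nu i S'.
Proof.
move=> mS mS' SS'.
pose T := (S `&` S') `|` (~` S `&` ~` S').
have mT : measurable T.
  by apply: measurableU; apply: measurableI => //; exact: measurableC.
have T1 : nu i T = 1%E.
  apply: nu_path => // x /SS' h; rewrite /T/=.
  by have [Sx|Sx] := pselect (S x); [left; split => //; apply/h|right; split => // /h].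
have D0 (A : set seqT) : measurable A -> nu i A = nu i (A `&` T).
  move=> mA; rewrite (measureDI _ mA mT) [X in (X + _)%E](_ : _ = 0%E) ?add0e//.
  apply: (@subset_measure0 _ _ _ _ _ (~` T)) => //; first exact: measurableD.
  - exact: measurableC.
  - by have := probability_setC (nu i) mT; rewrite T1 subee.
rewrite D0// [RHS]D0// (_ : S `&` T = S' `&` T)//; apply/seteqP.
by split=> x /= [? [[]|[]]] => // *; split => //; left.
Qed.

Lemma nu_fine i (S : set seqT) : measurable S -> nu i S = (fine (nu i S))%:E.
Proof. by move=> mS; rewrite fineK// fin_num_measure. Qed.

Lemma measurable_preimage_scons a (S : set seqT) :
  measurable S -> measurable (scons a @^-1` S : set seqT).
Proof. by move=> mS; rewrite -[X in measurable X]setTI; apply: measurable_scons. Qed.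

Lemma fine_nu_step i (S : set seqT) : measurable S ->
  fine (nu i S) = \sum_j p i j * fine (nu j (scons (lab i j) @^-1` S)).
Proof.
move=> mS; rewrite nu_step//.
rewrite (_ : (\sum_j _)%E = (\sum_j p i j * fine (nu j (scons (lab i j) @^-1` S)))%:E)//.
rewrite -sumEFin; apply: eq_bigr => j _; rewrite EFinM -nu_fine//.
exact: measurable_preimage_scons.
Qed.

(* Invariance makes [B] independent of every cylinder, hence of itself. *)
Lemma zero_one_law (B : set seqT) : measurable B ->
  (forall i j x, 0 < p i j -> path_word j x -> B (scons (lab i j) x) <-> B x) ->
  forall i0, nu i0 B != 0%E -> forall i, nu i B = 1%E.
Proof.
move=> mB HB i0 B0 i.
pose h := fine (nu i0 B).
(* Invariance turns the one-step formula for [B] into harmonicity of the masses, which are therefore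
   equal at all vertices. *)
have nuh j : nu j B = h%:E.
  rewrite nu_fine//; congr _%:E.
  apply: (@harmonic_const (fun k => fine (nu k B))) => k; rewrite fine_nu_step//.
  apply: eq_bigr => l _; have := p_ge0 k l; rewrite le_eqVlt => /predU1P[<-|pl].
    by rewrite !mul0r.
  congr (_ * fine _); apply: nu_ae_eq => //; first exact: measurable_preimage_scons.
  by move=> x xl; exact: HB.
have h0 : 0 <= h by rewrite fine_ge0.
have cylB e k : nu k (cyl e `&` B) = (h%:E * nu k (cyl e))%E.
  elim: e k => [|a e IH] k; first by rewrite cyl_nil setTI nuh probability_setT mule1.
  have mI : measurable (cyl (a :: e) `&` B : set seqT).
    by apply: measurableI => //; exact: measurable_cyl.
  rewrite nu_step// [in RHS]nu_step; last exact: measurable_cyl.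
  rewrite ge0_sume_distrr; last first.
    by move=> j _; rewrite mule_ge0// lee_fin.
  apply: eq_bigr => j _; rewrite muleCA; have := p_ge0 k j.
  rewrite le_eqVlt => /predU1P[<-|pj]; first by rewrite !mul0e.
  congr (_ * _)%E; rewrite scons_preimage_cyl.
  transitivity (nu j ((if lab k j == a then cyl e else set0) `&` B)).
    apply: nu_ae_eq => //; first exact: measurable_preimage_scons.
      by apply: measurableI => //; case: ifP => // _; exact: measurable_cyl.
    move=> x xj; rewrite -scons_preimage_cyl /=.
    by split=> -[ce Bx]; split=> //; apply/(HB k j x pj xj).
  by case: (lab k j == a); [exact: IH|rewrite set0I !measure0 mule0].
(* The restriction of [nu i] to [B] and [h] times [nu i] agree on cylinders, hence on [B] itself.
   This gives [h = h * h]. *)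
have BB : nu i (B `&` B) = (h%:E * nu i B)%E.
  apply: (@cyl_measure_unique R (mrestr (nu i) mB) (mscale (NngNum h0) (nu i))) => //.
    by move=> e; exact: cylB.
  by change (nu i (setT `&` B) < +oo)%E; rewrite setTI nuh ltry.
move: BB; rewrite setIid nuh -EFinM => -[/eqP].
rewrite -{1}(mulr1 h) -subr_eq0 -mulrBr mulf_eq0 subr_eq0 => /orP[/eqP h00|/eqP<-//].
by move: B0; rewrite nuh h00 eqxx.
Qed.

(** * Atoms of the images under [phi], and purity of mixtures *)

Variable beta : R.
Hypothesis beta1 : 1 < beta.

Let beta_gt0 : 0 < beta. Proof. exact: lt_trans ltr01 beta1. Qed.

Let L : R := \sum_i \sum_j `|(lab i j)%:~R|.

Let lab_le i j : `|(lab i j)%:~R| <= L.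
Proof.
rewrite /L (bigD1 i)//= (bigD1 j)//= -addrA lerDl addr_ge0//.
  by apply: sumr_ge0.
by apply: sumr_ge0 => k _; apply: sumr_ge0.
Qed.

Let path_word_le i x : path_word i x -> forall k, `|(x k)%:~R| <= L :> R.
Proof. by move=> [v [_ _ ->]] k; exact: lab_le. Qed.

Lemma measurable_preimage_phi (B : set (measurableTypeR R)) :
  measurable B -> measurable (phi beta @^-1` B : set seqT).
Proof. by move=> mB; rewrite -[X in measurable X]setTI; apply: measurable_phi. Qed.

Let atom i x := fine (nu i (phi beta @^-1` [set x])).

Let measurable_fiber x : measurable (phi beta @^-1` [set x] : set seqT).
Proof. by apply: measurable_preimage_phi; exact: measurable_set1. Qed.

Let atom_ge0 i x : 0 <= atom i x. Proof. exact: fine_ge0. Qed.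

(** By the functional equation, prefixing [lab i j] yields the value [x] exactly when the tail has
    value [beta * x - lab i j]. *)
Let atom_step i x : atom i x = \sum_j p i j * atom j (beta * x - (lab i j)%:~R).
Proof.
rewrite /atom fine_nu_step//; apply: eq_bigr => j _; congr (_ * fine _).
apply: nu_ae_eq => //; first exact: measurable_preimage_scons.
move=> y /path_word_le yL; rewrite /= (phi_scons beta1 yL); split => [<-|->].
  by field; exact: lt0r_neq0.
by field; exact: lt0r_neq0.
Qed.

Let atom_le i x : 0 < atom i x -> `|x| <= L / (beta - 1).
Proof.
move=> a0; rewrite leNgt; apply/negP => xL.
suff : atom i x = 0 by move=> a; rewrite a ltxx in a0.
rewrite /atom (@nu_ae_eq i _ set0)//; first by rewrite measure0.
move=> y /path_word_le yL; split => //= yx.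
by move: xL; rewrite -yx ltNge (phi_norm_le beta1 yL).
Qed.

(** Fibres over distinct points are disjoint, so more than [1 / e] atoms of mass at least [e] would
    exceed total mass 1. *)
Let atom_finite i e : 0 < e -> finite_set [set x | e <= atom i x].
Proof.
move=> e0; apply: contrapT => /infinite_set_fset H.
have [N Ne] : exists N : nat, 1 < N%:R * e.
  exists (Num.bound e^-1); rewrite -ltr_pdivrMr// div1r.
  by rewrite archi_boundP// invr_ge0 ltW.
have [F Fa FN] := H N.
have : ((\sum_(x <- finmap.enum_fset F) atom i x)%:E <= 1)%E.
  rewrite -sumEFin.
  rewrite (eq_bigr (fun x => nu i (phi beta @^-1` [set x]))); last first.
    by move=> x _; rewrite /atom -nu_fine.
  rewrite -measure_fbigsetU//; first by apply: probability_le1; exact: bigsetU_measurable.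
  by move=> x y _ _ [z [/= -> ->]].
apply/negP; rewrite -ltNge lte_fin (lt_le_trans Ne)//.
rewrite (@le_trans _ _ (\sum_(x <- finmap.enum_fset F) e))//.
  by rewrite big_const_seq count_predT iter_addr_0 -[leRHS]mulr_natl ler_wpM2r ?ler_nat// ltW.
rewrite big_seq [leRHS]big_seq; apply: ler_sum => x xF; exact: Fa.
Qed.

(** Only finitely many pairs carry at least the mass [e] of the given atom; the largest among these
    also dominates all atoms below [e]. *)
Let atom_max i0 x0 : 0 < atom i0 x0 ->
  exists i x, 0 < atom i x /\ forall j y, atom j y <= atom i x.
Proof.
move=> a0; pose e := atom i0 x0.
pose F : set ('I_n * R) := \bigcup_(i in [set: 'I_n]) (pair i @` [set x | e <= atom i x]).
have /finite_seqP[s Fs] : finite_set F.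
  by apply: bigcup_finite => // i _; apply: finite_image; exact: atom_finite.
have inF z : e <= atom z.1 z.2 -> z \in s.
  case: z => i x /= h; suff : [set` s] (i, x) by [].
  by rewrite -Fs; exists i => //; exists x.
have [z zs zmax] : exists2 z, z \in s & forall z', z' \in s -> atom z'.1 z'.2 <= atom z.1 z.2.
  have : s != [::] by apply/eqP => s0; have := inF (i0, x0) (lexx _); rewrite s0.
  elim: (s) => // z t IH _; have [->|/IH[w wt wmax]] := eqVneq t [::].
    by exists z; rewrite ?mem_head// => z'; rewrite inE => /eqP->.
  have [h|/ltW h] := leP (atom z.1 z.2) (atom w.1 w.2).
    exists w; rewrite ?inE ?wt ?orbT// => z'; rewrite inE => /predU1P[->//|]; exact: wmax.
  exists z; rewrite ?mem_head// => z'; rewrite inE => /predU1P[->//|/wmax/le_trans]; exact.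
have ez : e <= atom z.1 z.2 by apply: (zmax (i0, x0)); exact: inF.
exists z.1, z.2; split; first exact: lt_le_trans ez.
move=> j y; have [h|/ltW h] := leP e (atom j y); first exact: (zmax (j, y) (inF (j, y) h)).
exact: le_trans h ez.
Qed.

Lemma atomic_dichotomy :
  (forall i x, nu i (phi beta @^-1` [set x]) = 0%E) \/
  exists t : 'I_n -> R, forall i x, path_word i x -> phi beta x = t i.
Proof.
have [noatom|] := pselect (forall i x, atom i x = 0).
  by left => i x; rewrite nu_fine//; congr _%:E; exact: noatom.
move=> /existsNP[i0 /existsNP[x0 /eqP a0]]; right.
have {}a0 : 0 < atom i0 x0 by rewrite lt_neqAle eq_sym a0 atom_ge0.
have [i1 [x1 [m0 mmax]]] := atom_max a0.
pose m := atom i1 x1.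
have next i j x : atom i x = m -> 0 < p i j -> atom j (beta * x - (lab i j)%:~R) = m.
  move=> am pij; apply: (@average_max m (fun j => atom j (beta * x - (lab i j)%:~R)) i) => //.
  by rewrite -atom_step.
have : forall i, exists x, atom i x = m.
  apply: (@irreducible_closed (fun i => exists x, atom i x = m) _ i1); last by exists x1.
  by move=> i j [x ax] pij; exists (beta * x - (lab i j)%:~R); exact: next.
move=> /choice[t tm]; exists t => i x [v [v0 vp xE]].
(* [orb] follows the largest atom [t i] along the path: it stays a largest atom at every vertex
   visited, hence bounded, and [phi_orbit] identifies its starting point with [phi beta x]. *)
pose orb := fix orb k := if k is k'.+1 then beta * orb k' - (x k')%:~R else t i.
have orbm k : atom (v k) (orb k) = m.
  elim: k => [|k IH]; first by rewrite v0 tm.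
  by rewrite /= xE; exact: next.
rewrite (@phi_orbit _ _ beta1 x orb (L / (beta - 1))) => // k.
by apply: (@atom_le (v k)); rewrite orbm.
Qed.

Variables (w : 'I_n -> R) (mu : probability seqT R).
Hypothesis w_ge0 : forall i, 0 <= w i.
Hypothesis w_sum1 : \sum_i w i = 1.
Hypothesis mu_mix : forall S : set seqT, measurable S ->
  mu S = (\sum_i (w i)%:E * nu i S)%E.

Let pushphi_full (N : set (measurableTypeR R)) : measurable N ->
  (forall i, nu i (phi beta @^-1` N) = 1%E) -> pushphi beta mu (~` N) = 0%E.
Proof.
move=> mN N1; have mp := measurable_preimage_phi mN.
rewrite /pushphi preimage_setC probability_setC// mu_mix//.
rewrite (eq_bigr (fun i => (w i)%:E)) ?sumEFin ?w_sum1 ?subee// => i _.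
by rewrite N1 mule1.
Qed.

Let pushphi_null (N : set (measurableTypeR R)) : measurable N ->
  (forall i, nu i (phi beta @^-1` N) = 0%E) -> pushphi beta mu N = 0%E.
Proof.
move=> mN N0; rewrite /pushphi mu_mix; last exact: measurable_preimage_phi.
by rewrite big1// => i _; rewrite N0 mule0.
Qed.

Lemma pure_pushphi : pure_measure (pushphi beta mu).
Proof.
have [noatom|[t tE]] := atomic_dichotomy; last first.
  (* Each [nu i] is sent to the point mass at [t i], so the finite range of [t] carries the
     mixture. *)
  apply: Or33; exists (range t); split; first exact/finite_set_countable/finite_image.
  have mt : measurable (range t : set (measurableTypeR R)).
    apply: countable_measurable; first exact: measurable_set1.
    exact/finite_set_countable/finite_image.
  apply: pushphi_full => // i; apply: nu_path; first exact: measurable_preimage_phi.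
  by move=> x xi; exists i => //; rewrite (tE i x xi).
have [ac|] := pselect (abs_cont (pushphi beta mu)); first exact: Or31.
move=> /existsNP[B] /not_implyP[mB] /not_implyP[B0 nuB]; apply: Or32; split.
  by move=> x; apply: pushphi_null => //; exact: measurable_set1.
have [N [mN N0 BN Ninv]] := null_orbit_closure beta_gt0 mB B0.
exists N; split => //; apply: pushphi_full => //.
have [i0 i0B] : exists i, nu i (phi beta @^-1` B) != 0%E.
  apply: contrapT => H; apply: nuB; apply: pushphi_null => // i.
  by apply: contrapT => /eqP Hi; apply: H; exists i.
(* Stability of [N] under the affine maps becomes, through the functional equation, invariance of
   its preimage under prefixing an edge label. *)
apply: (@zero_one_law _ (measurable_preimage_phi mN) _ i0).
  move=> i j x pij /path_word_le xL; rewrite /= (phi_scons beta1 xL); exact: Ninv.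
apply: contra i0B => /eqP iN; apply/eqP.
apply: (subset_measure0 _ _ _ iN); [exact: measurable_preimage_phi..|].
by move=> x; exact: BN.
Qed.

(** Without atoms the countable set [S] would be null, against its full mass. The other branch of
    the dichotomy concerns all vertices, whatever the weights [w], so finiteness holds for the paths
    from every vertex. *)
Lemma pure_atomic_pushphi : pure_atomic (pushphi beta mu) ->
  finite_set (phi beta @` [set x | exists i, path_word i x]) /\
  atoms_at_most (pushphi beta mu) n.
Proof.
move=> [S [cS nuS]].
have mS : measurable (S : set (measurableTypeR R)).
  by apply: countable_measurable => //; exact: measurable_set1.
have [noatom|[t tE]] := atomic_dichotomy.
  exfalso; have S0 i : nu i (phi beta @^-1` S) = 0%E.
    have /countable_injP[f finj] := cS.
    apply/(negligibleP _ (measurable_preimage_phi mS)).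
    (* Numbering [S] injectively by [f] splits the preimage into countably many pieces, each empty
       or a single fibre. *)
    rewrite (_ : _ @^-1` S = \bigcup_k phi beta @^-1` (S `&` f @^-1` [set k])); last first.
      by apply/seteqP; split => y /=; [move=> Sy; exists (f (phi beta y))|move=> [k _ []]].
    apply: negligible_bigcup => k.
    have [[x [Sx fx]]|nx] := pselect (exists x, S x /\ f x = k).
      exists (phi beta @^-1` [set x]); split; [exact: measurable_preimage_phi|exact: noatom|].
      by move=> y /= [Sy fy]; apply: finj; rewrite ?inE// fy fx.
    exists set0; split => //.
    by move=> y /= [Sy fy]; apply: nx; exists (phi beta y).
  have := pushphi_null mS S0; rewrite /pushphi => S0'.
  move: nuS; rewrite /pushphi preimage_setC probability_setC;
    last exact: measurable_preimage_phi.
  by rewrite S0' sube0 => /eqP; rewrite onee_eq0.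
split.
  apply: (@sub_finite_set _ _ (range t)); last exact: finite_image.
  by move=> _ [x [i xi] <-]; exists i => //; rewrite (tE i x xi).
exists [seq t i | i <- enum 'I_n]; split; first by rewrite size_map size_enum_ord.
move=> x; apply: contraLR => xt; rewrite -leNgt.
have mx : measurable ([set x] : set (measurableTypeR R)) by exact: measurable_set1.
rewrite le_eqVlt; apply/orP; left; apply/eqP; apply: pushphi_null => // i.
rewrite (@nu_ae_eq i _ set0 (measurable_preimage_phi mx)) ?measure0//.
move=> y yi; split => //= yx; move: xt; rewrite -yx (tE i y yi).
by rewrite map_f ?mem_enum.
Qed.

End stochastic.

(** * Mixtures of laws, and the Parry chain of the graph *)

Lemma cyl_mixture (R : realType) (n : nat) (i0 : 'I_n) (w : 'I_n -> R)
    (nu : 'I_n -> probability seqT R) (mu : probability seqT R) :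
  (forall i, 0 <= w i) ->
  (forall e, mu (cyl e) = (\sum_i (w i)%:E * nu i (cyl e))%E) ->
  forall S, measurable S -> mu S = (\sum_i (w i)%:E * nu i S)%E.
Proof.
(* [msum] sums over natural numbers, so indices below [n] are decoded to vertices; [i0] only fills
   in beyond [n]. *)
move=> w0 muE S mS; pose ix (k : nat) := odflt i0 (insub k).
pose m := msum (fun k => mscale (NngNum (w0 (ix k))) (nu (ix k))) n.
have mE A : m A = (\sum_i (w i)%:E * nu i A)%E.
  by apply: eq_bigr => i _; rewrite /mscale/= /ix valK.
rewrite -mE; apply: cyl_measure_unique => //.
  by move=> e; exact: etrans (muE e) (esym (mE _)).
by have := probability_setT mu => /= ->; rewrite ltry.
Qed.

Section labelled_graph.
Variables (R : realType) (n : nat) (E : rel 'I_n) (lab : 'I_n -> 'I_n -> int).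
Variable A : seq int.
Hypotheses (Auniq : uniq A) (labA : forall i j, E i j -> lab i j \in A).
Variables (lam : R) (vR : 'cV[R]_n).
Hypotheses (lam_gt0 : 0 < lam) (vR_gt0 : forall i, 0 < vR i 0).
Hypothesis vR_eigen : Mtot R E lab A *m vR = lam *: vR.

(** [A] lists the label of each edge exactly once, so a single summand contributes. *)
Lemma MtotE i j : Mtot R E lab A i j = (E i j)%:R.
Proof.
rewrite /Mtot summxE (eq_bigr (fun a => (E i j && (lab i j == a))%:R)); last first.
  by move=> a _; rewrite mxE.
case: (boolP (E i j)) => [/labA labij|_]; last by rewrite big1.
rewrite (bigD1_seq (lab i j))//= eqxx big1 ?addr0// => a.
by rewrite eq_sym => /negPf->.
Qed.

Definition parry i j : R := (E i j)%:R * vR j 0 / (lam * vR i 0).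

Lemma parry_gt0 i j : (0 < parry i j) = E i j.
Proof.
rewrite /parry; case: (E i j); last by rewrite !mul0r ltxx.
by rewrite mul1r divr_gt0// mulr_gt0.
Qed.

Lemma parry_ge0 i j : 0 <= parry i j.
Proof. by rewrite divr_ge0// mulr_ge0// ltW// mulr_gt0. Qed.

Lemma parry_sum1 i : \sum_j parry i j = 1.
Proof.
rewrite /parry -big_distrl/= (_ : \sum_j _ = lam * vR i 0).
  by rewrite divff// mulf_neq0 ?lt0r_neq0.
transitivity ((Mtot R E lab A *m vR) i 0); last by rewrite vR_eigen mxE.
by rewrite mxE; apply: eq_bigr => j _; rewrite MtotE.
Qed.

(** A nonzero entry of a power of the matrix has a nonzero product among its terms; its factors are
    edges of a path from [i] to [j]. *)
Lemma primitive_connect : primitive_mx (Mtot R E lab A) -> forall i j, connect E i j.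
Proof.
move=> [_ [k Mk]] i j; have {Mk} := lt0r_neq0 (Mk i j).
elim: k i => [|k IH] i /=.
  by rewrite mxE; case: (i =P j) => [->|_]; rewrite ?eqxx// connect0.
rewrite mxE => s0; have [l lne0] : exists l,
    Mtot R E lab A i l * (foldr mulmx 1%:M (nseq k (Mtot R E lab A))) l j != 0.
  apply: contrapT => H; move: s0; rewrite big1 ?eqxx// => l _.
  by apply: contrapT => /eqP Hl; apply: H; exists l.
move: lne0; rewrite MtotE; case: (boolP (E i l)) => [Eil|_]; last by rewrite mul0r eqxx.
by rewrite mul1r => /IH; exact: connect_trans (connect1 Eil).
Qed.

Variable nu : 'I_n -> probability seqT R.
Hypothesis nu_step : forall i (S : set seqT), measurable S ->
  nu i S = (\sum_j (parry i j)%:E * nu j (scons (lab i j) @^-1` S))%E.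

(** Along a path the ratios [vR j / vR i] telescope, leaving the power of [lam] and the values of
    [vR] at the two ends. *)
Lemma parry_cyl e i :
  nu i (cyl e) = (lam ^- size e * (Mword R E lab e *m vR) i 0 / vR i 0)%:E.
Proof.
have vR0 j : vR j 0 != 0 by exact: lt0r_neq0.
elim: e i => [|a e IH] i.
  by rewrite cyl_nil probability_setT /= mul1mx expr0 invr1 mul1r divff.
rewrite nu_step; last exact: measurable_cyl.
transitivity (\sum_j (lam ^- size (a :: e) *
    (Mlab R E lab a i j * (Mword R E lab e *m vR) j 0) / vR i 0)%:E)%E.
  apply: eq_bigr => j _; rewrite scons_preimage_cyl mxE /parry.
  case: ifP => _; last by rewrite andbF mul0r mulr0 mul0r measure0 mule0.
  rewrite andbT IH -EFinM; congr _%:E; rewrite /= exprS.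
  by field; rewrite ?vR0 ?expf_neq0 ?lt0r_neq0.
rewrite sumEFin; congr _%:E; rewrite -big_distrl -big_distrr/=.
by rewrite -mulmxA [in RHS]mxE.
Qed.

(** With [u] equal to [vL] or to the indicator of [I] this covers both measures. The initial law is
    proportional to [u i * vR i], the factor [vR i] cancelling the denominator in [parry_cyl]. *)
Lemma parry_mixture (u : 'cV[R]_n) (mu : probability seqT R) :
  (forall i, 0 <= u i 0) -> 0 < (u^T *m vR) 0 0 ->
  (forall e, mu (cyl e) = (lam ^- size e * (u^T *m Mword R E lab e *m vR) 0 0
                            / (u^T *m vR) 0 0)%:E) ->
  exists w : 'I_n -> R, [/\ forall i, 0 <= w i, \sum_i w i = 1 &
    forall S, measurable S -> mu S = (\sum_i (w i)%:E * nu i S)%E].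
Proof.
move=> u0 s0 muE; set s := (u^T *m vR) 0 0 in s0 muE.
have sE : s = \sum_i u i 0 * vR i 0 by rewrite /s mxE; apply: eq_bigr => i _; rewrite mxE.
have w0 i : 0 <= u i 0 * vR i 0 / s by rewrite divr_ge0 ?mulr_ge0// ltW.
exists (fun i => u i 0 * vR i 0 / s); split => //.
  by rewrite -big_distrl/= -sE divff// lt0r_neq0.
have [i0 _] : exists i0 : 'I_n, True.
  apply: contrapT => H; move: s0; rewrite sE big1 ?ltxx// => i _.
  by exfalso; apply: H; exists i.
apply: (@cyl_mixture R n i0) => // e; rewrite muE.
transitivity (\sum_i (lam ^- size e * (u i 0 * (Mword R E lab e *m vR) i 0) / s)%:E)%E.
  rewrite sumEFin; congr _%:E; rewrite -big_distrl -big_distrr/= -mulmxA mxE.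
  by congr (_ * _ / _); apply: eq_bigr => i _; rewrite mxE.
apply: eq_bigr => i _; rewrite parry_cyl -EFinM; congr _%:E.
by field; rewrite ?expf_neq0 ?lt0r_neq0.
Qed.

End labelled_graph.

Unset Implicit Arguments.

Theorem theorem1 (R : realType) (n : nat)
  (E : rel 'I_n) (lab : 'I_n -> 'I_n -> int) (A : seq int)
  (HAuniq : uniq A) (HA : forall i j, E i j -> lab i j \in A)
  (I : {set 'I_n}) (HI : (0 < #|I|)%N)
  (Hprim : primitive_mx (Mtot R E lab A))
  (beta : R) (Hbeta : pisot beta)
  (lam : R) (vL vR : 'cV[R]_n)
  (Hlam : 0 < lam)
  (Hdom : forall z : R[i],
      root (char_poly (map_mx (fun x : R => (x%:C)%C) (Mtot R E lab A))) z ->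
      `|z| <= (lam%:C)%C)
  (HvL : forall i, 0 < vL i 0) (HvR : forall i, 0 < vR i 0)
  (HLeig : vL^T *m Mtot R E lab A = lam *: vL^T)
  (HReig : Mtot R E lab A *m vR = lam *: vR)
  (Hnorm : (vL^T *m vR) 0 0 = 1)
  (mu muI : probability seqT R)
  (Hmu : forall eps : seq int,
      mu (cyl eps) = (lam ^- size eps * (vL^T *m Mword R E lab eps *m vR) 0 0)%:E)
  (HmuI : forall eps : seq int,
      let vI : 'cV[R]_n := \col_i (i \in I)%:R in
      muI (cyl eps) = (lam ^- size eps * (vI^T *m Mword R E lab eps *m vR) 0 0
                        / (vI^T *m vR) 0 0)%:E) :
  let nu := pushphi beta mu in
  let nuI := pushphi beta muI in
  [/\ pure_measure nuI, pure_measure nu,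
      pure_atomic nu ->
        finite_set (phi beta @` Kplus E lab) /\ atoms_at_most nu n &
      pure_atomic nuI ->
        finite_set (phi beta @` Kplus E lab) /\ atoms_at_most nuI n].
Proof.
have [/= b1 _] := Hbeta.
have [nu [nu_path nu_step]] :=
  markov_laws_exist lab (parry_ge0 E Hlam HvR) (parry_sum1 HAuniq HA Hlam HvR HReig).
have irr i j : connect (fun i j => 0 < parry E lam vR i j) i j.
  rewrite (eq_connect (e' := E)); first exact: (primitive_connect HAuniq HA Hprim).
  by move=> a b; exact: parry_gt0.
(* Positive Parry transitions are exactly the edges, so path words from all vertices together fill
   [Kplus]. *)
have pathK : [set x | exists i, path_word (parry E lam vR) lab i x] = Kplus E lab.
  apply/seteqP; split=> x /=.
    move=> [i [v [_ vE ->]]]; exists v => k; split=> //.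
    by rewrite -(parry_gt0 E Hlam HvR).
  move=> [v vE]; exists (v 0%N), v; split=> //.
    by move=> k; rewrite parry_gt0//; case: (vE k).
  by apply/funext => k; case: (vE k).
have pure (u : 'cV[R]_n) (m : probability seqT R) :
    (forall i, 0 <= u i 0) -> 0 < (u^T *m vR) 0 0 ->
    (forall e, m (cyl e) = (lam ^- size e * (u^T *m Mword R E lab e *m vR) 0 0
                             / (u^T *m vR) 0 0)%:E) ->
    pure_measure (pushphi beta m) /\
    (pure_atomic (pushphi beta m) ->
      finite_set (phi beta @` Kplus E lab) /\ atoms_at_most (pushphi beta m) n).
  move=> u0 s0 mE.
  have p0 := parry_ge0 E Hlam HvR.
  have p1 := parry_sum1 HAuniq HA Hlam HvR HReig.
  have [w [w0 w1 mix]] := parry_mixture Hlam HvR nu_step u0 s0 mE.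
  split; first exact: (pure_pushphi p0 p1 irr nu_path nu_step b1 w1 mix).
  rewrite -pathK.
  exact: (pure_atomic_pushphi p0 p1 irr nu_path nu_step b1 mix).
have [pL aL] : pure_measure (pushphi beta mu) /\ (pure_atomic (pushphi beta mu) ->
    finite_set (phi beta @` Kplus E lab) /\ atoms_at_most (pushphi beta mu) n).
  apply: (pure vL) => [i||e]; [exact: ltW|by rewrite Hnorm|by rewrite Hmu Hnorm divr1].
have [pI aI] : pure_measure (pushphi beta muI) /\ (pure_atomic (pushphi beta muI) ->
    finite_set (phi beta @` Kplus E lab) /\ atoms_at_most (pushphi beta muI) n).
  apply: (pure (\col_i (i \in I)%:R)) => [i||e]; [by rewrite mxE| |exact: HmuI].
  (* A vertex of [I] contributes a positive term to the normalising constant. *)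
  have /card_gt0P[i0 i0I] := HI.
  rewrite mxE (bigD1 i0)//= !mxE i0I mul1r ltr_pwDl//.
  by apply: sumr_ge0 => i _; rewrite !mxE mulr_ge0// ltW.
by [].
Qed.
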